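(* Let $n\geq 2$ be a positive integer. Then $$\det(\mathrm{lcir}(\boldsymbol{c}_n(-i)))=\begin{cases}0 & \text{if } n\equiv 0 \pmod 4,\\ (-1)^{\frac{n-1}{2}}(2i)^{\frac{n-1}{2}} & \text{if } n\equiv 1\pmod 4\text{ or } n\equiv 3\pmod 4,\\ 2^{n-1} & \text{if } n\equiv 2\pmod 4.\end{cases}$$
   Context: Here $i$ is the imaginary unit. For $\boldsymbol{a}=(a_0,a_1,\dots,a_{n-1})\in\mathbb{C}^n$, $\mathrm{lcir}(\boldsymbol{a})$ denotes the $n\times n$ complex left circulant matrix with first row $\boldsymbol{a}$, each subsequent row being the preceding row rotated one position to the left; i.e., indexing rows and columns by $0,\dots,n-1$, its $(j,k)$ entry is $a_{(j+k)\bmod n}$. For a nonzero complex number $z$, $\boldsymbol{c}_n(z)=\left(\binom{n-1}{0}z^0,\binom{n-1}{1}z^1,\dots,\binom{n-1}{n-1}z^{n-1}\right)\in\mathbb{C}^n$ is the vector of coefficients of $(x+zy)^{n-1}$. *)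

(* Defs.v *)
From HB Require Import structures.
From mathcomp Require Import all_boot all_order all_algebra.
From mathcomp Require Import reals.
From mathcomp Require Import complex.

Set Implicit Arguments.
Unset Strict Implicit.
Unset Printing Implicit Defensive.

Import GRing.Theory.
Local Open Scope ring_scope.

(* Sum of indices modulo n; any i : 'I_n witnesses 0 < n, so no successor is
   needed in the dimension. *)
Definition ord_addm (n : nat) (i j : 'I_n) : 'I_n :=
  Ordinal (ltn_pmod (i + j) (leq_ltn_trans (leq0n i) (ltn_ord i))).

Definition lcir (T : Type) (n : nat) (a : 'rV[T]_n) : 'M[T]_n :=
  \matrix_(j < n, k < n) a 0 (ord_addm j k).

(* Coefficients of (x + z y)^(n-1), in order of increasing powers of y. *)
Definition cvec (C : pzRingType) (n : nat) (z : C) : 'rV[C]_n :=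
  \row_(k < n) ('C(n.-1, k)%:R * z ^+ k).

(* Main.v *)
(** With S the cyclic shift, reversing the columns of lcir(c_n(z)) gives
    (z I + S)^(n-1): expand by the binomial theorem and use the symmetry of
    binomial coefficients.  Since S is the companion matrix of X^n - 1,
    det(z I + S) = z^n - (-1)^n; the reversal contributes the sign
    (-1)^(n(n-1)/2), and it remains to put z = -i. *)
Require Import Defs.
From mathcomp Require Import all_boot all_order all_algebra.
From mathcomp Require Import reals.
From mathcomp Require Import complex.
From mathcomp Require Import perm zify ring.

Set Implicit Arguments.
Unset Strict Implicit.
Unset Printing Implicit Defensive.

Import GRing.Theory.
Local Open Scope ring_scope.

Definition shift_mx (R : pzSemiRingType) (n : nat) : 'M[R]_n :=
  \matrix_(i, j) (j == i.+1 %% n :> nat)%N%:R.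

Lemma horner_char_poly (R : comNzRingType) (n : nat) (A : 'M[R]_n) (x : R) :
  (char_poly A).[x] = \det (x%:M - A).
Proof.
rewrite -[LHS]/(horner_eval x _) -det_map_mx; congr (\det _).
by apply/matrixP => i j; rewrite !mxE /= /horner_eval !(hornerE, hornerMn).
Qed.

Lemma char_poly_shift_mx (R : comNzRingType) (n : nat) :
  char_poly (shift_mx R n.+1) = 'X^(n.+1) - 1.
Proof.
set p := 'X^(n.+1) - 1.
have sz : (size p).-1 = n.+1 by rewrite size_XnsubC.
(* [companionmx p] lives in dimension [(size p).-1], which equals [n.+1] only propositionally; the
   matrices are compared there and [sz] is rewritten at the end. *)
have shiftE : shift_mx R (size p).-1 = companionmx p.
  apply/matrixP => i j; rewrite !mxE.
  have := ltn_ord i; have := ltn_ord j; rewrite {2 4}sz => lt_jn lt_in.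
  rewrite [X in (_ %% X)%N]sz [X in _ == X.-1 :> nat]sz /=; case: (i =P n :> nat) => [-> | ne_in].
    by rewrite modnn coefB coefXn coef1 (ltn_eqF lt_jn) sub0r opprK.
  by rewrite modn_small 1?eq_sym // ltnS ltn_neqAle -ltnS lt_in andbT; apply/eqP.
by have := @companionmxK R p (monicXnsubC _ (ltn0Sn n)); rewrite -shiftE sz.
Qed.

(** Since zI + S = -((-z)I - S), this is the characteristic polynomial of S at -z, up to the sign
    (-1)^(n+1). *)
Lemma det_scalar_add_shift_mx (R : comNzRingType) (n : nat) (z : R) :
  \det (z%:M + shift_mx R n.+1) = z ^+ n.+1 - (-1) ^+ n.+1.
Proof.
rewrite -[_ + _]opprK opprD -[- z%:M]raddfN -scaleN1r detZ -horner_char_poly.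
rewrite char_poly_shift_mx !hornerE [(- z) ^+ _]exprNn mulrBr mulr1.
by rewrite mulrA -exprMn mulrNN mulr1 expr1n mul1r.
Qed.

Lemma shift_mxX (R : pzSemiRingType) (n k : nat) :
  shift_mx R n.+1 ^+ k = \matrix_(i, j) (j == (i + k) %% n.+1 :> nat)%N%:R.
Proof.
elim: k => [|k IHk]; apply/matrixP => i j.
  by rewrite expr0 !mxE addn0 modn_small // eq_sym.
rewrite exprSr IHk !mxE (bigD1 (inord ((i + k) %% n.+1))) //= !mxE.
rewrite inordK ?ltn_pmod // eqxx mul1r -[(_ %% _).+1%N]addn1 modnDml addn1 -addnS.
rewrite big1 ?addr0 // => l; rewrite !mxE -val_eqE /= inordK ?ltn_pmod //.
by move=> /negPf ->; rewrite mul0r.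
Qed.

(** Removing the index 0, which is sent to [ord_max], leaves the reversal of n points. The lift adds
    n to the parity, just as Pascal's rule adds n to C(n, 2). *)
Lemma odd_rev_perm (n : nat) :
  perm (@rev_ord_inj n) = odd 'C(n, 2) :> bool.
Proof.
elim: n => [|n IHn]; first by rewrite permS0 odd_perm1.
have -> : perm (@rev_ord_inj n.+1) =
          lift_perm ord0 ord_max (perm (@rev_ord_inj n)).
  apply/permP => i; rewrite permE; case: (unliftP ord0 i) => [j|] ->.
    rewrite lift_perm_lift permE; apply: val_inj => /=.
    rewrite /bump; have := ltn_ord j; lia.
  by rewrite lift_perm_id; apply: val_inj => /=; rewrite subn1.
by rewrite odd_lift_perm IHn binS oddD bin1 addbC.
Qed.

Lemma col_perm_rev_lcir_cvec (R : comNzRingType) (n : nat) (z : R) :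
  col_perm (perm (@rev_ord_inj n.+1)) (lcir (cvec n.+1 z)) =
  (z%:M + shift_mx R n.+1) ^+ n.
Proof.
have comm : GRing.comm (z%:M : 'M[R]_n.+1) (shift_mx R n.+1).
  by rewrite /GRing.comm -!mulmxE scalar_mxC.
rewrite exprDn_comm //; apply/matrixP => i j; rewrite !mxE summxE permE /=.
(* [k] is j - i modulo n+1, the only exponent for which S^k has a nonzero (i, j) entry; the reversed
   column index then yields the coefficient of index n - k. *)
pose k := inord (if (i <= j)%N then j - i else j + n.+1 - i)%N : 'I_n.+1.
have [lt_in lt_jn] := (ltn_ord i, ltn_ord j).
have [ikE revE] : ((i + k) %% n.+1 = j /\ (i + (n.+1 - j.+1)) %% n.+1 = n - k)%N.
  rewrite inordK; last by case: (leqP i j); lia.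
  case: (leqP i j) => [le_ij | lt_ji].
    by rewrite subnKC // !modn_small //; lia.
  have -> : (i + (j + n.+1 - i) = j + n.+1)%N by lia.
  have -> : (i + (n.+1 - j.+1) = i - j.+1 + n.+1)%N by lia.
  by rewrite !modnDr !modn_small //; lia.
rewrite (bigD1 k) //= big1 ?addr0 => [|l ne_lk].
  rewrite shift_mxX -rmorphXn /= -mulmxE mul_scalar_mx -scaler_nat !mxE.
  by rewrite ikE eqxx mulr1 revE bin_sub // -ltnS.
rewrite shift_mxX -rmorphXn /= -mulmxE mul_scalar_mx -scaler_nat !mxE.
(* A nonzero entry would force i + l = i + k modulo n+1, hence l = k, both being at most n. *)
case: eqP => [jE|_]; last by rewrite !mulr0.
case/eqP: ne_lk; apply: val_inj => /=.
by move/eqP: jE; rewrite -ikE eqn_modDl !modn_small // => /eqP.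
Qed.

Lemma det_mxX (R : comNzRingType) (n k : nat) (A : 'M[R]_n.+1) :
  \det (A ^+ k) = \det A ^+ k.
Proof. by elim: k => [|k IHk]; rewrite ?det1 // !exprS -mulmxE det_mulmx IHk. Qed.

Lemma det_lcir_cvec (R : comNzRingType) (n : nat) (z : R) :
  \det (lcir (cvec n.+1 z)) =
  (-1) ^+ 'C(n.+1, 2) * (z ^+ n.+1 - (-1) ^+ n.+1) ^+ n.
Proof.
rewrite -det_scalar_add_shift_mx -det_mxX.
(* The sign of the reversal now occurs on the right a second time, so the two cancel. *)
rewrite -col_perm_rev_lcir_cvec col_permE det_mulmx det_perm odd_permV.
by rewrite odd_rev_perm signr_odd mulrCA -expr2 sqrr_sign mulr1.
Qed.

Theorem theorem4p4 (R : realType) (n : nat) (hn : (2 <= n)%N) :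
  [/\ (n = 0 %[mod 4])%N ->
        \det (lcir (cvec n (- 'i%C : R[i]))) = 0,
      (n = 1 %[mod 4])%N \/ (n = 3 %[mod 4])%N ->
        \det (lcir (cvec n (- 'i%C : R[i]))) =
          (-1) ^+ ((n - 1) %/ 2)%N * (2 * 'i%C) ^+ ((n - 1) %/ 2)%N
    & (n = 2 %[mod 4])%N ->
        \det (lcir (cvec n (- 'i%C : R[i]))) = 2 ^+ (n - 1)%N].
Proof.
have [k [r [nE lt_r4]]] : exists k r, n = (4 * k + r)%N /\ (r < 4)%N.
  by exists (n %/ 4)%N, (n %% 4)%N; rewrite mulnC -divn_eq ltn_mod.
have iX4 : (- 'i%C : R[i]) ^+ 4 = 1.
  by rewrite (exprM _ 2 2) sqrrN sqr_i sqrrN expr1n.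
have sqr_1Di : (1 + 'i%C) ^+ 2 = 2 * 'i%C :> R[i].
  by rewrite sqrrD sqr_i; ring.
have sqr_1Bi : (1 - 'i%C) ^+ 2 = - (2 * 'i%C) :> R[i].
  by rewrite sqrrB sqr_i; ring.
have zX : (- 'i%C : R[i]) ^+ n = (- 'i%C) ^+ r.
  by rewrite nE exprD exprM iX4 expr1n mul1r.
have sX : (-1 : R[i]) ^+ n = (-1) ^+ r.
  by rewrite nE exprD exprM -[_ ^+ 4]signr_odd expr1n mul1r.
have detE : \det (lcir (cvec n (- 'i%C : R[i]))) =
    (-1) ^+ 'C(n, 2) * ((- 'i%C) ^+ r - (-1) ^+ r) ^+ (n - 1).
  rewrite -zX -sX; case: n hn {nE zX sX} => // m _.
  by rewrite det_lcir_cvec subn1.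
have binE : odd 'C(n, 2) = (1 < r)%N.
  (* The difference of the two binomials is 4m + 6, which is even. *)
  have odd_bin4 m : odd 'C(m.+4, 2) = odd 'C(m, 2).
    by rewrite !binS !bin1 !bin0 !oddD; case: (odd m); case: odd.
  rewrite nE; elim: k {nE} => [|k IHk]; last by rewrite mulnS odd_bin4.
  by case: r lt_r4 {zX sX detE} => [|[|[|[|]]]].
rewrite {}detE -signr_odd {}binE.
case: r lt_r4 nE {zX sX} => [|[|[|[|]]]] // _ nE; split => [nm|nm|nm]; try lia.
(* The base is 1 - 1 = 0; n >= 2 makes the exponent positive. *)
- have -> : (n - 1 = (n - 2).+1)%N by lia.
  by rewrite !expr0 subrr exprS mul0r mulr0.
- have -> : (n - 1 = 2 * (2 * k))%N by lia.
  have -> : (- 'i%C) ^+ 1 - (-1) ^+ 1 = 1 - 'i%C :> R[i] by ring.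
  by rewrite mulKn // exprM sqr_1Bi [(- (2 * _)) ^+ _]exprNn mul1r.
(* The exponent is odd, so the sign of the base -2 cancels the odd C(n, 2). *)
- have -> : (n - 1 = (2 * k).*2.+1)%N by lia.
  have -> : (- 'i%C) ^+ 2 - (-1) ^+ 2 = - 2 :> R[i] by rewrite !sqrrN sqr_i; ring.
  rewrite [(- 2) ^+ _]exprNn -[(-1) ^+ _.+1]signr_odd /= odd_double.
  by rewrite mulrA -expr2 sqrr_sign mul1r.
(* Here (1 + i)^2 = 2i brings no sign: the odd C(n, 2) supplies it, matching the odd (n-1)/2. *)
- have -> : (n - 1 = 2 * (2 * k).+1)%N by lia.
  have -> : (- 'i%C) ^+ 3 - (-1) ^+ 3 = 1 + 'i%C :> R[i].
    by rewrite exprS sqrrN sqr_i -[_ ^+ 3]signr_odd /=; ring.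
  by rewrite mulKn // exprM sqr_1Di -[in RHS]signr_odd /= oddM.
Qed.
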